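(* Let $\mathbb{K}$ be a unital commutative ring, $n\ge 2$, and let $V$ be the free $\mathbb{K}$-module on $\{x_1,\ldots,x_n\}$. Let $e(z):=1+\sum_{m\ge1}z^{\prec m}$, and let $H_m(x_1,\ldots,x_n)$, $m\ge2$, be the dendriform polynomials, homogeneous of total degree $m$, determined by $$e(x_1)\cdots e(x_n)=e\Big(x_1+\cdots+x_n+\sum_{m\ge2}H_m(x_1,\ldots,x_n)\Big)$$ in the completed free unital dendriform algebra $\mathbb{K}\,1\oplus Dend(V)^{\wedge}$. Let $h(x_1,\ldots,x_n)$ be the multilinear part of $H_n(x_1,\ldots,x_n)$. Then $h$ is the iterated pre-Lie product: $$h(x_1,\ldots,x_n)=\{x_1,\{x_2,\{\cdots\{x_{n-1},x_n\}\cdots\}\}\},$$ where $\{u,v\}:=u\succ v-v\prec u$.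
   Context: A dendriform algebra over $\mathbb{K}$ is a $\mathbb{K}$-module $A$ with two bilinear operations $\prec,\succ:A\otimes A\to A$ such that $(x\prec y)\prec z=x\prec(y\prec z)+x\prec(y\succ z)$, $(x\succ y)\prec z=x\succ(y\prec z)$, $(x\prec y)\succ z+(x\succ y)\succ z=x\succ(y\succ z)$. The product $xy:=x\prec y+x\succ y$ is associative. $Dend(V)=\bigoplus_{m\ge 1}Dend_m\otimes V^{\otimes m}$ is the free dendriform algebra on $V$, graded by degree $m$, and $Dend(V)^{\wedge}=\prod_{m\ge 1}Dend_m\otimes V^{\otimes m}$ is its completion. A unit $1$ is adjoined by $u\prec 1=u$, $1\prec u=0$, $u\succ 1=0$, $1\succ u=u$ for $u\in Dend(V)^{\wedge}$, while $1\prec1$ and $1\succ 1$ are not defined; the associative product is extended so that $1$ is a two-sided unit. For $z\in Dend(V)^{\wedge}$: $z^{\prec 1}=z$, $z^{\prec m}=z\prec(z^{\prec m-1})$. The multilinear part of a degree-$n$ element of $Dend(V)$ is its component spanned by the dendriform monomials in which each of $x_1,\ldots,x_n$ occurs exactly once. *)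

(* Defs.v *)
From HB Require Import structures.
From mathcomp Require Import all_boot all_algebra.
From mathcomp Require Import boolp.

Set Implicit Arguments.
Unset Strict Implicit.
Unset Printing Implicit Defensive.

Import GRing.Theory.
Local Open Scope ring_scope.

Declare Scope dend_scope.
Delimit Scope dend_scope with dend.

Reserved Notation "u ≺ v" (at level 40, left associativity).
Reserved Notation "u ≻ v" (at level 40, left associativity).
Reserved Notation "z ^≺ m" (at level 30, right associativity).

(** * Dendriform algebras *)

HB.mixin Record Lmodule_isDendriform (K : comPzRingType) A
    of GRing.Lmodule K A := {
  dprec : A -> A -> A;
  dsucc : A -> A -> A;
  dprec_linearl : forall z, linear (dprec^~ z);
  dprec_linearr : forall z, linear (dprec z);
  dsucc_linearl : forall z, linear (dsucc^~ z);
  dsucc_linearr : forall z, linear (dsucc z);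
  dend_axiom1 : forall x y z,
    dprec (dprec x y) z = dprec x (dprec y z) + dprec x (dsucc y z);
  dend_axiom2 : forall x y z,
    dprec (dsucc x y) z = dsucc x (dprec y z);
  dend_axiom3 : forall x y z,
    dsucc (dprec x y) z + dsucc (dsucc x y) z = dsucc x (dsucc y z)
}.

#[short(type="dendAlgType")]
HB.structure Definition Dendriform (K : comPzRingType) :=
  { A of GRing.Lmodule K A & Lmodule_isDendriform K A }.

Notation "u ≺ v" := (dprec u v) : dend_scope.
Notation "u ≻ v" := (dsucc u v) : dend_scope.
Local Open Scope dend_scope.

Section Operations.
Variables (K : comPzRingType) (A : dendAlgType K).
Implicit Types u v z : A.

Definition dmul u v : A := u ≺ v + u ≻ v.

Definition prelie u v : A := u ≻ v - v ≺ u.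

(* [:: u_1; ...; u_n] |-> {u_1, {u_2, ... {u_(n-1), u_n} ... }} *)
Fixpoint iter_prelie (s : seq A) : A :=
  match s with
  | [::] => 0
  | [:: u] => u
  | u :: s' => prelie u (iter_prelie s')
  end.

(* Right combs; the value at m = 0 is a convention and is never used. *)
Fixpoint precpow z (m : nat) : A :=
  match m with
  | 0 => 0
  | 1 => z
  | m'.+1 => z ≺ precpow z m'
  end.

Lemma dprec0l z : 0 ≺ z = 0.
Proof. by have := dprec_linearl z (-1) 0 0; rewrite scaler0 addr0 scaleN1r addNr. Qed.

Lemma dprec0r z : z ≺ 0 = 0.
Proof. by have := dprec_linearr z (-1) 0 0; rewrite scaler0 addr0 scaleN1r addNr. Qed.

Lemma dsucc0l z : 0 ≻ z = 0.
Proof. by have := dsucc_linearl z (-1) 0 0; rewrite scaler0 addr0 scaleN1r addNr. Qed.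

Lemma dsucc0r z : z ≻ 0 = 0.
Proof. by have := dsucc_linearr z (-1) 0 0; rewrite scaler0 addr0 scaleN1r addNr. Qed.

Lemma dprecDl z u v : (u + v) ≺ z = u ≺ z + v ≺ z.
Proof. by have := dprec_linearl z 1 u v; rewrite !scale1r. Qed.

Lemma dprecDr z u v : z ≺ (u + v) = z ≺ u + z ≺ v.
Proof. by have := dprec_linearr z 1 u v; rewrite !scale1r. Qed.

Lemma dsuccDl z u v : (u + v) ≻ z = u ≻ z + v ≻ z.
Proof. by have := dsucc_linearl z 1 u v; rewrite !scale1r. Qed.

Lemma dsuccDr z u v : z ≻ (u + v) = z ≻ u + z ≻ v.
Proof. by have := dsucc_linearr z 1 u v; rewrite !scale1r. Qed.

Lemma dprecZl z a u : (a *: u) ≺ z = a *: (u ≺ z).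
Proof. by have := dprec_linearl z a u 0; rewrite dprec0l !addr0. Qed.

Lemma dprecZr z a u : z ≺ (a *: u) = a *: (z ≺ u).
Proof. by have := dprec_linearr z a u 0; rewrite dprec0r !addr0. Qed.

Lemma dsuccZl z a u : (a *: u) ≻ z = a *: (u ≻ z).
Proof. by have := dsucc_linearl z a u 0; rewrite dsucc0l !addr0. Qed.

Lemma dsuccZr z a u : z ≻ (a *: u) = a *: (z ≻ u).
Proof. by have := dsucc_linearr z a u 0; rewrite dsucc0r !addr0. Qed.

Lemma dprec_suml I (r : seq I) (P : pred I) (F : I -> A) z :
  (\sum_(i <- r | P i) F i) ≺ z = \sum_(i <- r | P i) (F i ≺ z).
Proof.
exact: (big_morph (fun u => u ≺ z) (fun u v => dprecDl z u v) (dprec0l z)).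
Qed.

Lemma dprec_sumr I (r : seq I) (P : pred I) (F : I -> A) z :
  z ≺ (\sum_(i <- r | P i) F i) = \sum_(i <- r | P i) (z ≺ F i).
Proof. exact: (big_morph (dprec z) (dprecDr z) (dprec0r z)). Qed.

Lemma dsucc_suml I (r : seq I) (P : pred I) (F : I -> A) z :
  (\sum_(i <- r | P i) F i) ≻ z = \sum_(i <- r | P i) (F i ≻ z).
Proof.
exact: (big_morph (fun u => u ≻ z) (fun u v => dsuccDl z u v) (dsucc0l z)).
Qed.

Lemma dsucc_sumr I (r : seq I) (P : pred I) (F : I -> A) z :
  z ≻ (\sum_(i <- r | P i) F i) = \sum_(i <- r | P i) (z ≻ F i).
Proof. exact: (big_morph (dsucc z) (dsuccDr z) (dsucc0r z)). Qed.

End Operations.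

Notation "z ^≺ m" := (precpow z m) : dend_scope.

(** * The unital associative algebra K1 ⊕ A *)

Definition unitized (K : comPzRingType) (A : dendAlgType K) : Type := (K * A)%type.

Section Unitized.
Variables (K : comPzRingType) (A : dendAlgType K).

Definition uone : unitized A := (1, 0).

(* The bilinear extension of dmul for which 1 * u = 1 ≺ u + 1 ≻ u = u,
   u * 1 = u ≺ 1 + u ≻ 1 = u and 1 * 1 = 1. *)
Definition umul (p q : unitized A) : unitized A :=
  (p.1 * q.1, p.1 *: q.2 + q.1 *: p.2 + dmul p.2 q.2).

End Unitized.

Arguments uone {K A}.

(** * Free dendriform algebras *)

Definition dend_morphism (K : comPzRingType) (A B : dendAlgType K)
    (g : A -> B) : Prop :=
  [/\ linear g,
      forall u v, g (u ≺ v) = g u ≺ g v &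
      forall u v, g (u ≻ v) = g u ≻ g v].

Definition free_dendriform (K : comPzRingType) (V : lmodType K)
    (A : dendAlgType K) (iota : {linear V -> A}) : Prop :=
  forall (B : dendAlgType K) (f : {linear V -> B}),
    exists! g : A -> B, dend_morphism g /\ forall v, g (iota v) = f v.

(** * Dendriform monomials *)

Inductive dmono (n : nat) : Type :=
  | MVar of 'I_n
  | MPrec of dmono n & dmono n
  | MSucc of dmono n & dmono n.

Section Monomials.
Variable n : nat.
Implicit Type t : dmono n.

Fixpoint mdegree t : nat :=
  match t with
  | MVar _ => 1
  | MPrec t1 t2 | MSucc t1 t2 => mdegree t1 + mdegree t2
  end.

Fixpoint moccur t (i : 'I_n) : nat :=
  match t with
  | MVar j => (j == i)
  | MPrec t1 t2 | MSucc t1 t2 => moccur t1 i + moccur t2 i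
  end.

Definition multilinear_mono t : bool := [forall i, moccur t i == 1].

Variables (K : comPzRingType) (A : dendAlgType K) (x : 'I_n -> A).

Fixpoint meval t : A :=
  match t with
  | MVar i => x i
  | MPrec t1 t2 => meval t1 ≺ meval t2
  | MSucc t1 t2 => meval t1 ≻ meval t2
  end.

Definition mono_span (P : pred (dmono n)) (z : A) : Prop :=
  exists2 s : seq (K * dmono n),
    all (fun p => P p.2) s & z = \sum_(p <- s) p.1 *: meval p.2.

(* When A is free on the module with basis x, this is the component
   Dend_m ⊗ V^{⊗m}; it is 0 for m = 0. *)
Definition homogeneous (m : nat) : A -> Prop :=
  mono_span [pred t | mdegree t == m].

(* h is the component of z in the decomposition of A into the span of the
   multilinear monomials and the span of the other ones. *)
Definition multilinear_part (z h : A) : Prop :=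
  mono_span multilinear_mono h /\ mono_span (predC multilinear_mono) (z - h).

Lemma mono_span0 P : mono_span P 0.
Proof. by exists [::]; rewrite ?big_nil. Qed.

Lemma mono_spanD P u v : mono_span P u -> mono_span P v -> mono_span P (u + v).
Proof.
move=> [s sP ->] [r rP ->]; exists (s ++ r); first by rewrite all_cat sP.
by rewrite big_cat.
Qed.

Lemma mono_spanZ P a u : mono_span P u -> mono_span P (a *: u).
Proof.
move=> [s sP ->]; exists [seq (a * p.1, p.2) | p <- s]; first by rewrite all_map.
by rewrite big_map scaler_sumr; apply: eq_bigr => p _; rewrite scalerA.
Qed.

Lemma mono_spanN P u : mono_span P u -> mono_span P (- u).
Proof. by rewrite -scaleN1r; exact: mono_spanZ. Qed.

Lemma mono_span_sum P I (r : seq I) (Q : pred I) (F : I -> A) :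
  (forall i, Q i -> mono_span P (F i)) -> mono_span P (\sum_(i <- r | Q i) F i).
Proof. by apply: big_ind; [exact: mono_span0 | move=> u v; exact: mono_spanD]. Qed.

Lemma mono_span_mono (P : pred (dmono n)) t : P t -> mono_span P (meval t).
Proof.
by move=> Pt; exists [:: (1, t)]; rewrite /= ?Pt // big_seq1 scale1r.
Qed.

Lemma homogeneous_var i : homogeneous 1 (x i).
Proof. exact: (@mono_span_mono _ (MVar i)). Qed.

Lemma homogeneous0 u : homogeneous 0 u -> u = 0.
Proof.
case=> -[|[a t] s] /=; first by rewrite big_nil.
suff /lt0n_neq0/negPf-> : (0 < mdegree t)%N by [].
by elim: t => //= t1 t1_gt0 t2 _; rewrite addn_gt0 t1_gt0.
Qed.

Lemma mono_span_ind (P : pred (dmono n)) (Q : A -> Prop) :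
    Q 0 -> (forall u v, Q u -> Q v -> Q (u + v)) ->
    (forall a t, P t -> Q (a *: meval t)) ->
  forall z, mono_span P z -> Q z.
Proof.
move=> Q0 QD Qm z [s sP ->]; elim: s sP => [|p s IHs] /=; first by rewrite big_nil.
by case/andP=> pP /IHs Qs; rewrite big_cons; apply: QD; first exact: Qm.
Qed.

Lemma homogeneous_prec p q u v :
  homogeneous p u -> homogeneous q v -> homogeneous (p + q) (u ≺ v).
Proof.
move=> hu hv; move: u hu; apply: mono_span_ind => [|u1 u2 h1 h2|a s /eqP ds].
- by rewrite dprec0l; exact: mono_span0.
- by rewrite dprecDl; exact: mono_spanD.
rewrite dprecZl; apply: mono_spanZ; move: v hv.
apply: mono_span_ind => [|v1 v2 h1 h2|b t /eqP dt].
- by rewrite dprec0r; exact: mono_span0.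
- by rewrite dprecDr; exact: mono_spanD.
rewrite dprecZr; apply/mono_spanZ/(@mono_span_mono _ (MPrec s t)).
by rewrite /= ds dt.
Qed.

Lemma homogeneous_succ p q u v :
  homogeneous p u -> homogeneous q v -> homogeneous (p + q) (u ≻ v).
Proof.
move=> hu hv; move: u hu; apply: mono_span_ind => [|u1 u2 h1 h2|a s /eqP ds].
- by rewrite dsucc0l; exact: mono_span0.
- by rewrite dsuccDl; exact: mono_spanD.
rewrite dsuccZl; apply: mono_spanZ; move: v hv.
apply: mono_span_ind => [|v1 v2 h1 h2|b t /eqP dt].
- by rewrite dsucc0r; exact: mono_span0.
- by rewrite dsuccDr; exact: mono_spanD.
rewrite dsuccZr; apply/mono_spanZ/(@mono_span_mono _ (MSucc s t)).
by rewrite /= ds dt.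
Qed.

End Monomials.

(** * The completion: the product of the homogeneous components *)

Record completion (K : comPzRingType) (A : dendAlgType K) (n : nat)
    (x : 'I_n -> A) : Type := Completion {
  coef :> nat -> A;
  coefP : forall m, homogeneous x m (coef m)
}.

Section Completion.
Variables (K : comPzRingType) (A : dendAlgType K) (n : nat) (x : 'I_n -> A).

Local Notation hat := (completion x).
Implicit Types u v w z : hat.

Lemma completionP u v : coef u =1 coef v -> u = v.
Proof.
case: u v => [u uP] [v vP] /= /funext uv; case: _ / uv in vP *.
by congr Completion; exact: Prop_irrelevance.
Qed.

HB.instance Definition _ := gen_eqMixin hat.
HB.instance Definition _ := gen_choiceMixin hat.

Definition hat0 : hat := Completion (fun m => mono_span0 x _).
Definition hatN u : hat := Completion (fun m => mono_spanN (coefP u m)).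
Definition hatD u v : hat :=
  Completion (fun m => mono_spanD (coefP u m) (coefP v m)).
Definition hatZ (a : K) u : hat := Completion (fun m => mono_spanZ a (coefP u m)).

Fact hatDA : associative hatD.
Proof. by move=> u v w; apply: completionP => m /=; rewrite addrA. Qed.
Fact hatDC : commutative hatD.
Proof. by move=> u v; apply: completionP => m /=; rewrite addrC. Qed.
Fact hat0D : left_id hat0 hatD.
Proof. by move=> u; apply: completionP => m /=; rewrite add0r. Qed.
Fact hatND : left_inverse hat0 hatN hatD.
Proof. by move=> u; apply: completionP => m /=; rewrite addNr. Qed.
HB.instance Definition _ := GRing.isZmodule.Build hat hatDA hatDC hat0D hatND.

Fact hatZA a b u : hatZ a (hatZ b u) = hatZ (a * b) u.
Proof. by apply: completionP => m /=; rewrite scalerA. Qed.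
Fact hat1Z : left_id 1 hatZ.
Proof. by move=> u; apply: completionP => m /=; rewrite scale1r. Qed.
Fact hatZDr : right_distributive hatZ +%R.
Proof. by move=> a u v; apply: completionP => m /=; rewrite scalerDr. Qed.
Fact hatZDl u : {morph hatZ^~ u : a b / a + b}.
Proof. by move=> a b; apply: completionP => m /=; rewrite scalerDl. Qed.
HB.instance Definition _ :=
  GRing.Zmodule_isLmodule.Build K hat hatZA hat1Z hatZDr hatZDl.

Fact hat_prec_subproof u v m :
  homogeneous x m (\sum_(i < m.+1) (u i ≺ v (m - i)%N)).
Proof.
apply: mono_span_sum => i _; rewrite -{1}(subnKC (leq_ord i)).
by apply: homogeneous_prec; exact: coefP.
Qed.
Definition hat_prec u v : hat := Completion (hat_prec_subproof u v).

Fact hat_succ_subproof u v m :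
  homogeneous x m (\sum_(i < m.+1) (u i ≻ v (m - i)%N)).
Proof.
apply: mono_span_sum => i _; rewrite -{1}(subnKC (leq_ord i)).
by apply: homogeneous_succ; exact: coefP.
Qed.
Definition hat_succ u v : hat := Completion (hat_succ_subproof u v).

Fact hat_prec_linearl z : linear (hat_prec^~ z).
Proof.
move=> a u v; apply: completionP => m /=.
rewrite scaler_sumr -big_split; apply: eq_bigr => i _ /=.
by rewrite dprec_linearl.
Qed.
Fact hat_prec_linearr z : linear (hat_prec z).
Proof.
move=> a u v; apply: completionP => m /=.
rewrite scaler_sumr -big_split; apply: eq_bigr => i _ /=.
by rewrite dprec_linearr.
Qed.
Fact hat_succ_linearl z : linear (hat_succ^~ z).
Proof.
move=> a u v; apply: completionP => m /=.
rewrite scaler_sumr -big_split; apply: eq_bigr => i _ /=.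
by rewrite dsucc_linearl.
Qed.
Fact hat_succ_linearr z : linear (hat_succ z).
Proof.
move=> a u v; apply: completionP => m /=.
rewrite scaler_sumr -big_split; apply: eq_bigr => i _ /=.
by rewrite dsucc_linearr.
Qed.

Fact triangle_reindex (F : nat -> nat -> nat -> A) m :
  \sum_(i < m.+1) \sum_(j < i.+1) F j (i - j)%N (m - i)%N =
  \sum_(i < m.+1) \sum_(j < (m - i).+1) F i j (m - i - j)%N.
Proof.
under eq_bigr => i _.
  rewrite (big_ord_widen _ (fun j => F j (i - j)%N (m - i)%N) (ltn_ord i)).
  over.
rewrite (exchange_big_dep xpredT) //=; apply: eq_bigr => j _.
have jm : (j <= m)%N by rewrite -ltnS.
rewrite -(big_mkord (fun i => (j <= i)%N) (fun i => F j (i - j)%N (m - i)%N)).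
rewrite -(big_mkord xpredT (fun i => F j i (m - j - i)%N)).
rewrite (eq_bigl (fun i => xpredT i && (j <= i)%N)) //.
rewrite -(big_nat_widenl j 0 m.+1 xpredT) // -{1}[nat_of_ord j]add0n big_addn subSn //.
by apply: eq_bigr => i _; rewrite addnK addnC subnDA.
Qed.

Fact hat_dend_axiom1 u v w :
  hat_prec (hat_prec u v) w =
  hat_prec u (hat_prec v w) + hat_prec u (hat_succ v w).
Proof.
apply: completionP => m /=; rewrite -big_split /=.
under eq_bigr do rewrite dprec_suml.
under [RHS]eq_bigr do rewrite !dprec_sumr -big_split.
rewrite (triangle_reindex (fun i j k => u i ≺ v j ≺ w k)).
by do 2!apply: eq_bigr => ? _; rewrite dend_axiom1.
Qed.

Fact hat_dend_axiom2 u v w :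
  hat_prec (hat_succ u v) w = hat_succ u (hat_prec v w).
Proof.
apply: completionP => m /=.
under eq_bigr do rewrite dprec_suml.
under [RHS]eq_bigr do rewrite dsucc_sumr.
rewrite (triangle_reindex (fun i j k => (u i ≻ v j) ≺ w k)).
by do 2!apply: eq_bigr => ? _; rewrite dend_axiom2.
Qed.

Fact hat_dend_axiom3 u v w :
  hat_succ (hat_prec u v) w + hat_succ (hat_succ u v) w =
  hat_succ u (hat_succ v w).
Proof.
apply: completionP => m /=; rewrite -big_split /=.
under eq_bigr do rewrite !dsucc_suml -big_split.
under [RHS]eq_bigr do rewrite dsucc_sumr.
rewrite (triangle_reindex (fun i j k => (u i ≺ v j) ≻ w k + (u i ≻ v j) ≻ w k)).
by do 2!apply: eq_bigr => ? _; rewrite dend_axiom3.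
Qed.

HB.instance Definition _ := Lmodule_isDendriform.Build K hat
  hat_prec_linearl hat_prec_linearr hat_succ_linearl hat_succ_linearr
  hat_dend_axiom1 hat_dend_axiom2 hat_dend_axiom3.

Fact hat_var_subproof i m : homogeneous x m (if m == 1%N then x i else 0).
Proof. by case: eqP => [->|_]; [exact: homogeneous_var | exact: mono_span0]. Qed.

Definition hat_var i : hat := Completion (hat_var_subproof i).

Fact hat_tail_subproof (H : nat -> A)
    (hH : forall m, (2 <= m)%N -> homogeneous x m (H m)) m :
  homogeneous x m (if (2 <= m)%N then H m else 0).
Proof. by case: ifP => [/hH|_]; last exact: mono_span0. Qed.

(* \sum_(m >= 2) H m *)
Definition hat_tail (H : nat -> A)
    (hH : forall m, (2 <= m)%N -> homogeneous x m (H m)) : hat :=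
  Completion (hat_tail_subproof hH).

(* z ^≺ m has no component of degree < m, so the degree k component of
   \sum_(m >= 1) z ^≺ m is a finite sum. *)
Lemma coef_precpow z m k : (k < m)%N -> (z ^≺ m) k = 0.
Proof.
have z0 : z 0 = 0 by apply: homogeneous0; exact: coefP.
elim: m k => // -[|m] IHm k; first by case: k.
rewrite ltnS => km; have -> : z ^≺ m.+2 = z ≺ (z ^≺ m.+1) by [].
rewrite [LHS]/=; apply: big1 => -[[|i] /= ik] _; first by rewrite z0 dprec0l.
rewrite IHm ?dprec0r //; case: k km ik => // k km _.
by rewrite subSS ltnS (leq_trans (leq_subr _ _)).
Qed.

Fact hat_geom_subproof z m :
  homogeneous x m (\sum_(1 <= k < m.+1) coef (z ^≺ k) m).
Proof. by apply: mono_span_sum => k _; exact: coefP. Qed.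

Definition hat_geom z : hat := Completion (hat_geom_subproof z).

Definition dend_exp z : unitized hat := (1, hat_geom z).

End Completion.

(* Main.v *)
(* Give each variable a formal factor eps_i with eps_i^2 = 0: sending x_i to
   eps_i x_i kills every monomial in which a variable is repeated, and the
   coefficient of eps_1 ... eps_n is the multilinear part.  After this
   substitution e(x_i) becomes 1 + X_i, with X_i = eps_i x_i and X_i * X_i = 0.
   Since e(Z) = 1 + Z ≺ e(Z) determines Z, it suffices to exhibit the logarithm
   of e(X_i) e(Z), which is X_i + Z + {X_i, Z}.  Iterating, the coefficient of
   eps_1 ... eps_n is the iterated pre-Lie product. *)
Require Import Defs.
From HB Require Import structures.
From mathcomp Require Import all_boot all_algebra.

Set Implicit Arguments.
Unset Strict Implicit.
Unset Printing Implicit Defensive.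

Import GRing.Theory.
Local Open Scope ring_scope.
Local Open Scope dend_scope.

(** * Extension of scalars by square-zero parameters *)

Section SubsetConvolution.
Variables (I : finType) (K : comPzRingType) (A : dendAlgType K).

(* [A] tensored with K[eps_i : i \in I] / (eps_i ^ 2): [f S] is the coefficient
   of the product of the [eps_i] for [i \in S]. *)
Definition subset_alg : Type := {ffun {set I} -> A}.
HB.instance Definition _ := GRing.Lmodule.on subset_alg.

Implicit Types f g k : subset_alg.

(** The products of the eps_i over [T] and over [U] multiply to the one over their union if [T] and
    [U] are disjoint, and to 0 otherwise; only complementary pairs in [S] contribute. *)
Definition conv (op : A -> A -> A) f g : subset_alg :=
  [ffun S : {set I} => \sum_(T : {set I} | T \subset S) op (f T) (g (S :\: T))].

(** Both sides sum over the ordered splittings of [S] into three blocks, with [T] the union of [U]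
    and [W]. Each dendriform axiom then holds termwise. *)
Fact subset_reindex (F : {set I} -> {set I} -> {set I} -> A) (S : {set I}) :
  \sum_(T : {set I} | T \subset S) \sum_(U : {set I} | U \subset T)
    F U (T :\: U) (S :\: T) =
  \sum_(U : {set I} | U \subset S) \sum_(W : {set I} | W \subset S :\: U)
    F U W (S :\: U :\: W).
Proof.
rewrite (exchange_big_dep (fun U : {set I} => U \subset S)) /=; last first.
  by move=> T U TS UT; exact: subset_trans UT TS.
apply: eq_bigr => U US.
rewrite (reindex_onto (fun W : {set I} => U :|: W)
  (fun T : {set I} => T :\: U)) /=; last first.
  by move=> T /andP[_ UT]; rewrite -[RHS](setID T U) (setIidPr UT).
apply: eq_big => [W|W].
  rewrite subUset US subsetUl andbT /= subsetD; congr (_ && _).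
  by rewrite setDUl setDv set0U; apply/eqP/idP => /setDidPl.
by case/andP=> _ /eqP{1}->; rewrite setDDl.
Qed.

Fact conv_linearl op : (forall z, linear (op^~ z)) ->
  forall g, linear ((conv op)^~ g).
Proof.
move=> opl g a f1 f2; apply/ffunP => S; rewrite !ffunE scaler_sumr -big_split.
by apply: eq_bigr => T _ /=; rewrite !ffunE opl.
Qed.

Fact conv_linearr op : (forall z, linear (op z)) ->
  forall f, linear (conv op f).
Proof.
move=> opr f a g1 g2; apply/ffunP => S; rewrite !ffunE scaler_sumr -big_split.
by apply: eq_bigr => T _ /=; rewrite !ffunE opr.
Qed.

Fact conv_axiom1 f g k :
  conv (@dprec K A) (conv (@dprec K A) f g) k =
  conv (@dprec K A) f (conv (@dprec K A) g k) +
  conv (@dprec K A) f (conv (@dsucc K A) g k).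
Proof.
apply/ffunP => S; rewrite !ffunE -big_split /=.
under eq_bigr do rewrite ffunE dprec_suml.
under [RHS]eq_bigr do rewrite !ffunE !dprec_sumr -big_split.
rewrite (subset_reindex (fun U V W => f U ≺ g V ≺ k W)).
by do 2!apply: eq_bigr => ? _; rewrite dend_axiom1.
Qed.

Fact conv_axiom2 f g k :
  conv (@dprec K A) (conv (@dsucc K A) f g) k =
  conv (@dsucc K A) f (conv (@dprec K A) g k).
Proof.
apply/ffunP => S; rewrite !ffunE.
under eq_bigr do rewrite ffunE dprec_suml.
under [RHS]eq_bigr do rewrite !ffunE !dsucc_sumr.
rewrite (subset_reindex (fun U V W => (f U ≻ g V) ≺ k W)).
by do 2!apply: eq_bigr => ? _; rewrite dend_axiom2.
Qed.

Fact conv_axiom3 f g k :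
  conv (@dsucc K A) (conv (@dprec K A) f g) k +
  conv (@dsucc K A) (conv (@dsucc K A) f g) k =
  conv (@dsucc K A) f (conv (@dsucc K A) g k).
Proof.
apply/ffunP => S; rewrite !ffunE -big_split /=.
under eq_bigr do rewrite !ffunE !dsucc_suml -big_split.
under [RHS]eq_bigr do rewrite !ffunE !dsucc_sumr.
rewrite (subset_reindex (fun U V W => (f U ≺ g V) ≻ k W + (f U ≻ g V) ≻ k W)).
by do 2!apply: eq_bigr => ? _; rewrite dend_axiom3.
Qed.

HB.instance Definition _ := Lmodule_isDendriform.Build K subset_alg
  (conv_linearl (@dprec_linearl K A)) (conv_linearr (@dprec_linearr K A))
  (conv_linearl (@dsucc_linearl K A)) (conv_linearr (@dsucc_linearr K A))
  conv_axiom1 conv_axiom2 conv_axiom3.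

Lemma subset_precE f g S :
  (f ≺ g) S = \sum_(T : {set I} | T \subset S) f T ≺ g (S :\: T).
Proof. by rewrite ffunE. Qed.

Lemma subset_succE f g S :
  (f ≻ g) S = \sum_(T : {set I} | T \subset S) f T ≻ g (S :\: T).
Proof. by rewrite ffunE. Qed.

(** The element eps_i [a]. *)
Definition subset_var i (a : A) : subset_alg :=
  [ffun S : {set I} => if S == [set i] then a else 0].

Lemma conv_varl (op : A -> A -> A) i a f S : (forall z, op 0 z = 0) ->
  conv op (subset_var i a) f S = if i \in S then op a (f (S :\ i)) else 0.
Proof.
move=> op0; rewrite ffunE; case: ifP => iS; last first.
  apply: big1 => T TS; rewrite ffunE; case: eqP => // eT.
  by rewrite eT sub1set iS in TS.
rewrite (bigD1 [set i]) ?sub1set //= ffunE eqxx big1 ?addr0 // => T /andP[_].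
by rewrite ffunE => /negPf->.
Qed.

Lemma conv_varr (op : A -> A -> A) i a f S : (forall z, op z 0 = 0) ->
  conv op f (subset_var i a) S = if i \in S then op (f (S :\ i)) a else 0.
Proof.
move=> op0; rewrite ffunE; case: ifP => iS; last first.
  apply: big1 => T TS; rewrite ffunE; case: eqP => // eT.
  by have := set11 i; rewrite -eT inE iS andbF.
have eS : S :\: (S :\ i) = [set i].
  by rewrite setDDr setDv set0U; apply/setIidPr; rewrite sub1set.
rewrite (bigD1 (S :\ i)) ?subD1set //= ffunE eS eqxx big1 ?addr0 // => T.
(* A nonzero term needs [S :\: T] to be the singleton of [i], which forces [T] to be [S :\ i]. *)
case/andP=> TS /eqP nT; rewrite ffunE; case: eqP => // eT; case: nT.
by rewrite -eT setDDr setDv set0U; apply/esym/setIidPr.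
Qed.

Lemma var_precE i a f S :
  (subset_var i a ≺ f) S = if i \in S then a ≺ f (S :\ i) else 0.
Proof. exact/conv_varl/dprec0l. Qed.

Lemma var_succE i a f S :
  (subset_var i a ≻ f) S = if i \in S then a ≻ f (S :\ i) else 0.
Proof. exact/conv_varl/dsucc0l. Qed.

Lemma prec_varE i a f S :
  (f ≺ subset_var i a) S = if i \in S then f (S :\ i) ≺ a else 0.
Proof. exact/conv_varr/dprec0r. Qed.

Lemma subset_addE f g S : (f + g) S = f S + g S.
Proof. by rewrite ffunE. Qed.

Lemma subset_subE f g S : (f - g) S = f S - g S.
Proof. by rewrite !ffunE. Qed.

Lemma prelie_varE i a f S :
  prelie (subset_var i a) f S = if i \in S then prelie a (f (S :\ i)) else 0.
Proof.
rewrite subset_subE var_succE prec_varE.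
by case: ifP => // _; rewrite subrr.
Qed.

(** This and the next three lemmas express eps_i^2 = 0: the outer factor removes [i] from the set,
    and the inner one has no coefficient on a set without [i]. *)
Lemma var_prec_prec i a b f : subset_var i a ≺ (subset_var i b ≺ f) = 0.
Proof.
by apply/ffunP => S; rewrite !var_precE setD11 dprec0r if_same ffunE.
Qed.

Lemma var_prec_var i a b : subset_var i a ≺ subset_var i b = 0.
Proof.
apply/ffunP => S; rewrite var_precE !ffunE.
case: eqP => [eS|]; last by rewrite dprec0r; case: ifP.
by have := set11 i; rewrite -eS setD11.
Qed.

Lemma var_succ_var i a b : subset_var i a ≻ subset_var i b = 0.
Proof.
apply/ffunP => S; rewrite var_succE !ffunE.
case: eqP => [eS|]; last by rewrite dsucc0r; case: ifP.
by have := set11 i; rewrite -eS setD11.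
Qed.

Lemma var_succ_prec_var i a b f : subset_var i a ≻ (f ≺ subset_var i b) = 0.
Proof.
by apply/ffunP => S; rewrite var_succE prec_varE setD11 dsucc0r if_same ffunE.
Qed.

(* Induction on the cardinal of the set: [E set0 = 0] removes [z S] from
   the convolution [(z ≺ E) S]. *)
Lemma dend_log_unique (E z1 z2 : subset_alg) : E set0 = 0 ->
  E = z1 + z1 ≺ E -> E = z2 + z2 ≺ E -> z1 = z2.
Proof.
move=> E0 E1 E2; apply/ffunP => S.
have [m] := ubnP #|S|; elim: m S => // m IHm S leSm.
have /ffunP/(_ S) := etrans (esym E1) E2.
rewrite !ffunE (bigD1 S) //= [in RHS](bigD1 S) //= setDv E0 !dprec0r !add0r.
rewrite (eq_bigr (fun T : {set I} => z2 T ≺ E (S :\: T))); first exact: addIr.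
move=> T /andP[TS nTS]; rewrite IHm //.
rewrite ltnS in leSm; apply: leq_trans leSm; apply: proper_card.
by rewrite properEneq nTS.
Qed.

End SubsetConvolution.

(** * Logarithm of a product with a square-zero factor *)

Section Logarithm.
Variables (K : comPzRingType) (A : dendAlgType K).

(* As [X * X = 0], [e(X) = 1 + X] has inverse [1 - X], and the logarithm of
   [e(X) e(Z)] is [X + (e(X) ≻ Z) ≺ e(X)^-1], in which the terms with two
   factors [X] vanish. *)
Lemma dend_log_step (X Z E : A) :
    X ≺ X = 0 -> X ≻ X = 0 -> X ≻ (Z ≺ X) = 0 -> E = Z + Z ≺ E ->
  let Z' := X + Z + prelie X Z in let E' := E + X + dmul X E in
  E' = Z' + Z' ≺ E'.
Proof.
move=> XpX XsX XsZpX eE /=; rewrite /prelie /dmul.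
(* The parenthesis is [E'], that is e(X) e(Z) - 1; these four facts compute [Z' ≺ E'] term by
   term. *)
have XE : X ≺ (E + X + (X ≺ E + X ≻ E)) = X ≺ E.
  by rewrite !dprecDr XpX addr0 -dend_axiom1 XpX dprec0l addr0.
have ZE : Z ≺ (E + X + (X ≺ E + X ≻ E)) = Z ≺ E + Z ≺ X + (Z ≺ X) ≺ E.
  by rewrite !dprecDr dend_axiom1.
have XZE : (X ≻ Z) ≺ (E + X + (X ≺ E + X ≻ E)) = X ≻ (Z ≺ E).
  rewrite dend_axiom2 ZE !dsuccDr XsZpX addr0.
  by rewrite -(dend_axiom2 X (Z ≺ X)) XsZpX dprec0l addr0.
have ZXE : (Z ≺ X) ≺ (E + X + (X ≺ E + X ≻ E)) = (Z ≺ X) ≺ E.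
  have ZXX : (Z ≺ X) ≺ X = 0 by rewrite dend_axiom1 XpX XsX dprec0r addr0.
  by rewrite !dprecDr ZXX addr0 -dend_axiom1 ZXX dprec0l addr0.
have NE u v : (- u) ≺ v = - (u ≺ v) :> A by rewrite -scaleN1r dprecZl scaleN1r.
rewrite [in RHS]dprecDl [in RHS]dprecDl [in RHS]dprecDl NE XE ZE XZE ZXE.
have XsE : X ≻ E = X ≻ Z + X ≻ (Z ≺ E) by rewrite {1}eE dsuccDr.
rewrite XsE {1}eE.
rewrite !addrA.
(* The permutation pairs the opposite terms in [Z ≺ X] and in [(Z ≺ X) ≺ E], then lists the other
   six in the order of the left-hand side. *)
rewrite [RHS](ACl ((4*7)*(8*10)*2*6*1*5*3*9))/=.
by rewrite addNr subrr !add0r.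
Qed.

End Logarithm.

(** * Functional equation of the exponential *)

Section Geometric.
Variables (K : comPzRingType) (A : dendAlgType K) (n : nat) (x : 'I_n -> A).
Implicit Types u v z : completion x.

Lemma coef0 u : u 0 = 0.
Proof. exact/homogeneous0/coefP. Qed.

Lemma hat_geom_trunc z m N : (m < N)%N ->
  hat_geom z m = \sum_(1 <= k < N) coef (precpow z k) m.
Proof.
move=> mN; rewrite (@big_cat_nat _ _ _ m.+1) //= [X in _ = _ + X]big_nat_cond.
by rewrite [X in _ = _ + X]big1 ?addr0 // => k; rewrite andbT => /andP[mk _];
  exact: coef_precpow.
Qed.

Lemma hat_geomE z : hat_geom z = z + z ≺ hat_geom z.
Proof.
(* One term beyond degree [m] is kept, so that after the first is split off and the index shifted,
   the sum still covers all degrees up to [m]. *)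
apply: completionP => m; rewrite (@hat_geom_trunc z m m.+2) //.
rewrite big_ltn // big_add1 -pred_Sn big_nat_cond; congr (_ + _).
under eq_bigr => k /andP[/andP[k1 _] _].
  have -> : precpow z k.+1 = z ≺ precpow z k by case: k k1.
  over.
rewrite -big_nat_cond /= exchange_big /=; apply: eq_bigr => i _.
by rewrite -dprec_sumr -hat_geom_trunc // ltnS leq_subr.
Qed.

End Geometric.

(** * Multilinear coefficients and the substitution of eps_i x_i for x_i *)

Section MultilinearPart.
Variables (K : comPzRingType) (A : dendAlgType K) (n : nat) (x : 'I_n -> A).
Local Notation B := (subset_alg 'I_n A).

Definition mono_on (S : {set 'I_n}) (t : dmono n) : bool :=
  [forall i, moccur t i == (i \in S)].

Lemma mono_onT t : mono_on setT t = multilinear_mono t.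
Proof. by apply: eq_forallb => i; rewrite inE. Qed.

Lemma mdegreeE (t : dmono n) : mdegree t = (\sum_i moccur t i)%N.
Proof.
elim: t => [j|t1 IH1 t2 IH2|t1 IH1 t2 IH2] /=; last 2 first.
- by rewrite big_split /= IH1 IH2.
- by rewrite big_split /= IH1 IH2.
by rewrite (bigD1 j) //= eqxx big1 ?addn0 // => i /negPf; rewrite eq_sym => ->.
Qed.

Lemma mono_on_degree (S : {set 'I_n}) t : mono_on S t -> mdegree t = #|S|.
Proof.
move=> /forallP St; rewrite mdegreeE -sum1_card [RHS]big_mkcond /=.
by apply: eq_bigr => i _; rewrite (eqP (St i)); case: (i \in S).
Qed.

Lemma conv_mono (op : A -> A -> A) (a b : A) t1 t2 (S : {set 'I_n}) :
    (forall z, op 0 z = 0) -> (forall z, op z 0 = 0) ->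
  \sum_(T : {set 'I_n} | T \subset S)
     op (if mono_on T t1 then a else 0) (if mono_on (S :\: T) t2 then b else 0)
  = if [forall i, moccur t1 i + moccur t2 i == (i \in S)]%N then op a b else 0.
Proof.
move=> op0l op0r; case: ifP => [/forallP St|/negP nSt]; last first.
  apply: big1 => T /subsetP TS.
  case: ifP => // /forallP T1; case: ifP => // /forallP T2; case: nSt.
  apply/forallP => i; rewrite (eqP (T1 i)) (eqP (T2 i)) inE.
  by have := TS i; case: (i \in T) => // ->.
(* The only [T] that can contribute is the set of variables occurring in [t1]. *)
pose T1 : {set 'I_n} := [set i | moccur t1 i != 0]%N.
rewrite (bigD1 T1) /=; last first.
  apply/subsetP => i; rewrite inE; have := St i.
  by case: (i \in S) => //; rewrite addn_eq0 => /andP[->].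
have -> : mono_on T1 t1.
  apply/forallP => i; rewrite inE; have := St i.
  by case: (i \in S); case: (moccur t1 i) => [|[|k]].
have -> : mono_on (S :\: T1) t2.
  apply/forallP => i; rewrite !inE; have := St i.
  by case: (i \in S); case: (moccur t1 i) => [|[|k]].
rewrite big1 ?addr0 // => T /andP[_ nT]; case: ifP => // /forallP Tt.
case/eqP: nT; apply/setP => i; rewrite inE (eqP (Tt i)).
by case: (i \in T).
Qed.

Variable g : A -> B.
Hypothesis (gM : dend_morphism g) (gx : forall i, g (x i) = subset_var i (x i)).

Let gD u v : g (u + v) = g u + g v.
Proof. by case: gM => /(_ 1 u v); rewrite !scale1r. Qed.

Let g0 : g 0 = 0.
Proof. by apply: (addrI (g 0)); rewrite -gD !addr0. Qed.

Let gZ a u : g (a *: u) = a *: g u.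
Proof. by case: gM => /(_ a u 0); rewrite g0 !addr0. Qed.

Let g_sum I (r : seq I) (P : pred I) (F : I -> A) :
  g (\sum_(i <- r | P i) F i) = \sum_(i <- r | P i) g (F i).
Proof. exact: (big_morph g gD g0). Qed.

Lemma subset_mono t S : g (meval x t) S = if mono_on S t then meval x t else 0.
Proof.
elim: t S => [i|t1 IH1 t2 IH2|t1 IH1 t2 IH2] S /=; last 2 first.
- case: gM => _ -> _; rewrite subset_precE.
  under eq_bigr do rewrite IH1 IH2.
  exact: conv_mono (@dprec0l _ _) (@dprec0r _ _).
- case: gM => _ _ ->; rewrite subset_succE.
  under eq_bigr do rewrite IH1 IH2.
  exact: conv_mono (@dsucc0l _ _) (@dsucc0r _ _).
rewrite gx ffunE; congr (if _ then _ else _).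
apply/eqP/forallP => [-> j|Si]; first by rewrite inE (eq_sym j).
apply/setP => j; rewrite inE; have /= := Si j; rewrite (eq_sym i).
by case: (j \in S); case: (j == i).
Qed.

Lemma subset_homogeneous m u (S : {set 'I_n}) :
  homogeneous x m u -> #|S| != m -> g u S = 0.
Proof.
move=> hu Sm; move: u hu; apply: mono_span_ind => [|u v u0 v0|a t /eqP tm].
- by rewrite g0 ffunE.
- by rewrite gD ffunE u0 v0 addr0.
rewrite gZ ffunE subset_mono; case: ifP => [/mono_on_degree tS|].
  by rewrite -tS tm eqxx in Sm.
by rewrite scaler0.
Qed.

(** The coefficient at [setT] fixes each multilinear monomial and kills all others. *)
Lemma multilinear_partE z h : multilinear_part x z h -> h = g z setT.
Proof.
case=> h1 h2; rewrite -(subrK h z) gD ffunE.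
have -> : g (z - h) setT = 0.
  move: (z - h) h2; apply: mono_span_ind => [|u v u0 v0|a t /negPf tT].
  - by rewrite g0 ffunE.
  - by rewrite gD ffunE u0 v0 addr0.
  by rewrite gZ ffunE subset_mono mono_onT tT scaler0.
rewrite add0r; move: h h1 {h2}; apply: mono_span_ind => [|u v u0 v0|a t tT].
- by rewrite g0 ffunE.
- by rewrite gD ffunE -u0 -v0.
by rewrite gZ ffunE subset_mono mono_onT tT.
Qed.

(** This extends [g] to the completion: only the component of degree [#|S|] can have a coefficient
    at [S], so no infinite sum arises. *)
Definition hat_subset (u : completion x) : B :=
  [ffun S : {set 'I_n} => g (u #|S|) S].

Lemma hat_subsetD u v : hat_subset (u + v) = hat_subset u + hat_subset v.
Proof. by apply/ffunP => S; rewrite !ffunE /= gD ffunE. Qed.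

Lemma hat_conv (op : A -> A -> A) (u v : completion x) (S : {set 'I_n}) :
    (forall z, op 0 z = 0) -> (forall z, op z 0 = 0) ->
  \sum_(i < #|S|.+1) \sum_(T : {set 'I_n} | T \subset S)
    op (g (u i) T) (g (v (#|S| - i)%N) (S :\: T)) =
  \sum_(T : {set 'I_n} | T \subset S)
    op (g (u #|T|) T) (g (v #|S :\: T|) (S :\: T)).
Proof.
move=> op0l op0r; rewrite exchange_big /=; apply: eq_bigr => T TS.
have ltT : (#|T| < #|S|.+1)%N by rewrite ltnS subset_leq_card.
rewrite (bigD1 (Ordinal ltT)) //= big1 ?addr0.
  by rewrite cardsD (setIidPr TS).
move=> i neT; rewrite (@subset_homogeneous i) //; first exact: coefP.
by apply: contra neT => /eqP eT; apply/eqP/val_inj.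
Qed.

Lemma hat_subset_prec u v : hat_subset (u ≺ v) = hat_subset u ≺ hat_subset v.
Proof.
apply/ffunP => S; rewrite subset_precE ffunE /= g_sum sum_ffunE.
under [RHS]eq_bigr do rewrite !ffunE.
rewrite -(hat_conv _ _ _ (@dprec0l _ _) (@dprec0r _ _)).
by apply: eq_bigr => i _; case: gM => _ -> _; rewrite subset_precE.
Qed.

Lemma hat_subset_succ u v : hat_subset (u ≻ v) = hat_subset u ≻ hat_subset v.
Proof.
apply/ffunP => S; rewrite subset_succE ffunE /= g_sum sum_ffunE.
under [RHS]eq_bigr do rewrite !ffunE.
rewrite -(hat_conv _ _ _ (@dsucc0l _ _) (@dsucc0r _ _)).
by apply: eq_bigr => i _; case: gM => _ _ ->; rewrite subset_succE.
Qed.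

Lemma hat_subset_var i : hat_subset (hat_var x i) = subset_var i (x i).
Proof.
apply/ffunP => S; rewrite !ffunE /=.
case: eqP => [S1|/eqP S1]; first by rewrite gx ffunE.
rewrite g0 ffunE; case: eqP => // eS; by rewrite eS cards1 in S1.
Qed.

Lemma hat_subset_geom z :
  hat_subset (hat_geom z) =
  hat_subset z + hat_subset z ≺ hat_subset (hat_geom z).
Proof. by rewrite {1}hat_geomE hat_subsetD hat_subset_prec. Qed.

Lemma hat_subset_geom_var i :
  hat_subset (hat_geom (hat_var x i)) = subset_var i (x i).
Proof.
(* Two unfoldings suffice, since both X ≺ X and X ≺ (X ≺ _) vanish. *)
rewrite hat_subset_geom hat_subset_var hat_subset_geom hat_subset_var.
by rewrite dprecDr var_prec_var add0r var_prec_prec addr0.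
Qed.

Fixpoint log_prod (s : seq 'I_n) : B :=
  if s is i :: s' then
    let X := subset_var i (x i) in let Z := log_prod s' in X + Z + prelie X Z
  else 0.

(** The unit component 1 is carried through the induction because it gives [umul] the shape
    [E + X + dmul X E] of [dend_log_step]. *)
Lemma log_prodP s :
  let p := \big[@umul K (completion x)/uone]_(i <- s) dend_exp (hat_var x i) in
  p.1 = 1 /\ hat_subset p.2 = log_prod s + log_prod s ≺ hat_subset p.2.
Proof.
elim: s => [|i s] /=.
  rewrite big_nil; split=> //=; apply/ffunP => S.
  by rewrite dprec0l addr0 !ffunE g0 ffunE.
rewrite big_cons; set p := (\big[_/_]_(_ <- s) _) => -[p1 IHs].
split; first by rewrite /= p1 mulr1.
rewrite /= p1 !scale1r /dmul !hat_subsetD hat_subset_prec hat_subset_succ.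
rewrite !hat_subset_geom_var.
apply: dend_log_step => //; [exact: var_prec_var|exact: var_succ_var|].
exact: var_succ_prec_var.
Qed.

Lemma log_prodE i s (S : {set 'I_n}) :
  log_prod (i :: s) S =
  subset_var i (x i) S + log_prod s S +
  (if i \in S then prelie (x i) (log_prod s (S :\ i)) else 0).
Proof. by rewrite -prelie_varE -!subset_addE. Qed.

Lemma prelie0r (u : A) : prelie u 0 = 0.
Proof. by rewrite /prelie dsucc0r dprec0l subr0. Qed.

Lemma log_prod_support s (S : {set 'I_n}) : ~~ (S \subset s) -> log_prod s S = 0.
Proof.
elim: s S => [|i s IHs] S nS; first by rewrite ffunE.
have subS (T : {set 'I_n}) : T \subset s -> T \subset i :: s.
  by move=> /subsetP Ts; apply/subsetP => j /Ts js; rewrite inE js orbT.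
rewrite log_prodE ffunE IHs ?addr0; last by apply: contra nS; exact: subS.
rewrite [X in _ + X](_ : _ = 0) ?addr0.
  case: eqP => // eS; case/negP: nS.
  by apply/subsetP => j; rewrite eS !inE => ->.
case: ifP => // iS; rewrite IHs ?prelie0r //.
apply: contra nS => /subsetP Ss; apply/subsetP => j jS.
by rewrite inE; case: eqP => //= /eqP ji; apply: Ss; rewrite !inE ji.
Qed.

(** In X + Z + {X, Z}, Z has no coefficient at a set containing [i], as [i] is not in [s]; X counts
    only when [s] is empty, where {X, Z} vanishes. *)
Lemma log_prod_top s :
  uniq s -> log_prod s [set j in s] = iter_prelie [seq x j | j <- s].
Proof.
elim: s => [|i s IHs]; first by rewrite ffunE.
case/andP=> nis /IHs{}IHs; rewrite log_prodE.
have -> : [set j in i :: s] :\ i = [set j in s].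
  apply/setP => j; rewrite !inE; case: eqP => //= ->.
  by rewrite (negPf nis).
rewrite inE mem_head IHs log_prod_support ?addr0; last first.
  apply/negP => /subsetP/(_ i); rewrite !inE eqxx => /(_ isT).
  exact/negP.
rewrite ffunE; case: s nis {IHs} => [|j s] nis /=.
  by rewrite prelie0r addr0 set_cons set_nil setU0 eqxx.
case: eqP => [/setP/(_ j)|]; last by rewrite add0r.
rewrite !inE eqxx orbT => /esym/eqP ij.
by rewrite ij inE eqxx in nis.
Qed.

End MultilinearPart.

(** Freeness is applied with the square-zero extension of [A] itself as target. *)
Lemma free_dendriform_subset (K : comPzRingType) (n : nat)
    (A : dendAlgType K) (iota : {linear 'rV[K]_n -> A}) (x : 'I_n -> A) :
    free_dendriform iota -> (forall i, x i = iota (delta_mx 0 i)) ->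
  exists2 g : A -> subset_alg 'I_n A,
    dend_morphism g & forall i, g (x i) = subset_var i (x i).
Proof.
move=> freeA hx.
pose f (v : 'rV[K]_n) : subset_alg 'I_n A :=
  \sum_i v 0 i *: subset_var i (x i).
have f_lin : linear f.
  move=> a u v; rewrite /f scaler_sumr -big_split /=; apply: eq_bigr => i _.
  by rewrite !mxE scalerDl scalerA.
pose fL := HB.pack_for {linear 'rV[K]_n -> subset_alg 'I_n A} f
  (GRing.isLinear.Build _ _ _ _ f f_lin).
have [g [[gM gf] _]] := freeA _ fL.
exists g => // i; rewrite {1}hx gf /= /f (bigD1 i) //= mxE !eqxx scale1r.
rewrite big1 ?addr0 // => j ji.
by rewrite mxE (negPf ji) andbF scale0r.
Qed.

Theorem proposition3p6 (K : comPzRingType) (n : nat) (hn : (2 <= n)%N)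
  (A : dendAlgType K) (iota : {linear 'rV[K]_n -> A})
  (hA : free_dendriform iota)
  (x : 'I_n -> A) (hx : forall i, x i = iota (delta_mx 0 i))
  (H : nat -> A)
  (hH : forall m, (2 <= m)%N -> homogeneous x m (H m))
  (hexp : \big[@umul K (completion x)/uone]_(i < n) dend_exp (hat_var x i)
          = dend_exp (\sum_(i < n) hat_var x i + hat_tail hH))
  (h : A) (hh : multilinear_part x (H n) h) :
  h = iter_prelie [seq x i | i <- enum 'I_n].
Proof.
have [g gM gx] := free_dendriform_subset hA hx.
set z := _ + _ in hexp.
(* The variables sit in degree 1 and [n] is at least 2, so they do not contribute. *)
have zn : z n = H n.
  rewrite /z /= hn.
  rewrite (big_morph (fun u : completion x => u n) (id1 := 0) (op1 := +%R)) //.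
  by rewrite big1 ?add0r // => i _ /=; case: eqP hn => // ->.
(* [Ep] and [Ez] present [log_prod] and the image of [z] as logarithms of the same element. *)
have [_] := log_prodP gM gx (index_enum 'I_n); rewrite hexp /= => Ep.
have Ez := hat_subset_geom gM gx z.
have E0 : hat_subset g (hat_geom z) set0 = 0.
  rewrite ffunE cards0 coef0.
  (* Zero is also homogeneous of degree 1, which differs from the cardinal of the empty set. *)
  by rewrite (subset_homogeneous gM gx (m := 1) (mono_span0 x _)) // cards0.
rewrite (multilinear_partE gM gx hh).
have -> : g (H n) setT = hat_subset g z setT by rewrite ffunE cardsT card_ord zn.
have -> : enum 'I_n = index_enum 'I_n by rewrite [index_enum _]unlock enumT.
rewrite (dend_log_unique E0 Ez Ep) -log_prod_top ?index_enum_uniq //.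
by congr (log_prod _ _ _); apply/setP => i; rewrite !inE mem_index_enum.
Qed.
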